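(* Let $H$ be a finite-dimensional real inner-product space, $F$ a symmetric (self-adjoint) operator on $H$ and $Q$ a density operator on $H$. Then for every $\epsilon>0$ there exists a univariate polynomial $p$ of degree $k\le C(1+S(Q\,\|\,\mathcal U))\cdot\|F\|/\epsilon$, with $C>0$ a universal constant, such that the density operator $\tilde Q=\frac{1}{\mathrm{Tr}\,p(F)^2}p(F)^2$ satisfies $\mathrm{Tr}(F\tilde Q)\le\mathrm{Tr}(FQ)+\epsilon$.
   Context: A density operator is a positive semidefinite self-adjoint operator of trace one. $\mathcal U=\mathrm{Id}/\mathrm{Tr}(\mathrm{Id})$ is the uniform density operator on $H$. The quantum relative entropy is $S(X\,\|\,Y)=\mathrm{Tr}(X(\log X-\log Y))$ (natural logarithm). $\|F\|$ is the operator norm. *)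

(* Defs.v *)
From HB Require Import structures.
From mathcomp Require Import all_boot all_order all_algebra.
From mathcomp Require Import all_classical all_reals all_analysis.

Set Implicit Arguments.
Unset Strict Implicit.
Unset Printing Implicit Defensive.

Import Order.TTheory GRing.Theory Num.Theory.
Import passmx.

Local Open Scope classical_set_scope.
Local Open Scope ring_scope.

(* A finite-dimensional real inner-product space is a pair of H : vectType R  *)
(* and dot : {dot H for idfun}, a symmetric positive definite bilinear form.  *)

Section Operators.
Context {R : realType} {H : vectType R}.
Implicit Types (A B X Y : 'End(H)) (p : {poly R}).

(* Independent of the basis, so any basis may serve. *)
Definition optrace A : R :=
  \tr (mxof (vbasis {:H}) (vbasis {:H}) A).

(* 'End(H) has no ring structure in the library, because H may be 0; hence    *)
(* horner_alg is not available here.                                          *)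
Definition oppow A (i : nat) : 'End(H) := iter i (comp_lfun A) \1%VF.

Definition oppoly p A : 'End(H) := \sum_(i < size p) p`_i *: oppow A i.

(* The operator acting as the scalar f l on the eigenspace ker (A - l Id) for *)
(* every l. It exists and is unique when A is self-adjoint, H then being the  *)
(* sum of the eigenspaces of A.                                               *)
Definition opfun (f : R -> R) A : 'End(H) :=
  xget (0 : 'End(H))
    [set B : 'End(H) | forall l v, A v = l *: v -> B v = f l *: v].

(* As ln 0 = 0 in the library, the logarithm vanishes on ker A, so that       *)
(* X log X follows the convention 0 log 0 = 0.                                *)
Definition oplog A : 'End(H) := opfun (@ln R) A.

(* Meaningful when ker Y is contained in ker X, in particular for Y           *)
(* invertible; otherwise the usual value is +oo.                              *)
Definition rel_entropy X Y : R := optrace (X \o (oplog X - oplog Y))%VF.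

Definition uniform_density : 'End(H) := (optrace \1%VF)^-1 *: \1%VF.

Definition poly_density p A : 'End(H) :=
  let B := (oppoly p A \o oppoly p A)%VF in (optrace B)^-1 *: B.

Variable dot : {dot H for idfun}.

Definition self_adjoint A := forall u v : H, dot (A u) v = dot u (A v).

Definition pos_semidef A := forall u : H, 0 <= dot (A u) u.

Definition density_op A :=
  [/\ self_adjoint A, pos_semidef A & optrace A = 1].

Definition vnorm (u : H) : R := Num.sqrt (dot u u).

Definition opnorm A : R :=
  sup [set r | exists2 u : H, vnorm u <= 1 & r = vnorm (A u)].

End Operators.

Arguments uniform_density {R} H.

(* Main.v *)
(** Put [M = ||F||], [s = S(Q || U)], [b = 2 (1 + s) / eps], and let [p] be the
    Taylor polynomial of degree [k ~ 2 b M] of [exp] composed with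
    [x |-> b (M - x) / 2].  Markov's inequality for a Poisson variable gives
    [exp y / 2 <= T_k y <= exp y] for [0 <= y <= k / 2], so that on the spectrum
    of [F] the function [- ln p^2] is [b (x - M)] up to an additive error of
    [2 ln 2].  By Klein's inequality, [p(F)^2 / Tr p(F)^2] minimises
    [X |-> Tr (X (- ln p(F)^2)) + S(X || U)]; comparing with [X = Q] gives
    [b Tr (F Q~) <= b Tr (F Q) + s + 2 ln 2].  A constant relative error in the
    approximation of the exponential is thus enough, and its price is the
    [1] in [1 + s].  When [2 M <= eps] the constant polynomial does. *)

Require Import Defs.
From HB Require Import structures.
From mathcomp Require Import all_boot all_order all_algebra.
From mathcomp Require Import all_classical all_reals all_analysis.
From mathcomp Require Import ring lra.
From mathcomp Require complex.

Set Implicit Arguments.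
Unset Strict Implicit.
Unset Printing Implicit Defensive.

Import Order.TTheory GRing.Theory Num.Theory.
Import passmx.

Local Open Scope ring_scope.

Section Eigen.
Import complex.

(* [u + i v] is an eigenvector of [M] over [R[i]] for the eigenvalue [a + i b]. *)
Lemma mx_complex_eigenvector (R : realType) n (M : 'M[R]_n) : (0 < n)%N ->
  exists a b : R, exists u v : 'rV[R]_n,
    [/\ (u != 0) || (v != 0), u *m M = a *: u - b *: v
      & v *m M = b *: u + a *: v].
Proof.
move=> n0; pose N := map_mx (real_complex R) M.
have szN : size (char_poly N) != 1%N.
  by rewrite size_char_poly; case: n n0 {M N}.
have [z] := closed_rootP _ szN.
rewrite -eigenvalue_root_char => /eigenvalueP [w wN w0].
exists (complex.Re z), (complex.Im z).
exists (map_mx (@complex.Re R) w), (map_mx (@complex.Im R) w).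
have ReM j : complex.Re ((w *m N) 0 j) = (map_mx (@complex.Re R) w *m M) 0 j.
  rewrite !mxE raddf_sum; apply: eq_bigr => i _; rewrite !mxE.
  by case: (w 0 i) => x y /=; ring.
have ImM j : complex.Im ((w *m N) 0 j) = (map_mx (@complex.Im R) w *m M) 0 j.
  rewrite !mxE raddf_sum; apply: eq_bigr => i _; rewrite !mxE.
  by case: (w 0 i) => x y /=; ring.
split.
- rewrite -negb_and; apply: contra w0 => /andP[/eqP/rowP u0 /eqP/rowP v0].
  apply/eqP/rowP => j; move: (u0 j) (v0 j); rewrite !mxE.
  by case: (w 0 j) => x y /= -> ->.
- apply/rowP => j; rewrite -ReM wN !mxE.
  by case: (w 0 j) => x y; case: (z) => a b /=; ring.
- apply/rowP => j; rewrite -ImM wN !mxE.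
  by case: (w 0 j) => x y; case: (z) => a b /=; ring.
Qed.

End Eigen.

Lemma symmetric_eigenvector (R : realType) (V : vectType R) (A : 'End(V))
    (d : V -> V -> R) :
  (forall a u v w, d (a *: u + v) w = a * d u w + d v w) ->
  (forall u v, d u v = d v u) -> (forall u, u != 0 -> 0 < d u u) ->
  (forall u v, d (A u) v = d u (A v)) -> (0 < dim V)%N ->
  exists l v, v != 0 /\ A v = l *: v.
Proof.
move=> dL dC d_gt0 dA V0.
have bB := vbasisP {: V}.
have n0 : (0 < \dim {: V})%N by rewrite dimvf.
have [a [b [x [y [xy0 xM yM]]]]] :=
  mx_complex_eigenvector (mxof (vbasis {:V}) (vbasis {:V}) A) n0.
pose u := vecof (vbasis {:V}) x; pose v := vecof (vbasis {:V}) y.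
have Au : A u = a *: u - b *: v.
  by rewrite /u -[A _](rVofK bB) -mul_mxof xM linearB !linearZ.
have Av : A v = b *: u + a *: v.
  by rewrite /v -[A _](rVofK bB) -mul_mxof yM linearD !linearZ.
have uv0 : (u != 0) || (v != 0).
  by move: xy0; rewrite !vecof_eq0.
have d0 w : d 0 w = 0.
  have := dL 1 0 0 w; rewrite scale1r addr0 mul1r => /esym/eqP.
  by rewrite -subr_eq0 addrK => /eqP.
have dZ c x' w : d (c *: x') w = c * d x' w.
  by rewrite -[_ *: _]addr0 dL d0 addr0.
(* Symmetry of [A] on the pair [u], [v] forces the eigenvalue to be real. *)
have b0 : b = 0.
  have e : b * (d u u + d v v) = 0.
    have := dA u v; rewrite (dC u (A v)) Au Av dL -scaleNr dZ dL dZ (dC v u).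
    by lra.
  have d_ge0 w : 0 <= d w w.
    by have [->|/d_gt0/ltW//] := eqVneq w 0; rewrite d0.
  move/eqP: e; rewrite mulf_eq0 => /orP[/eqP//|].
  rewrite gt_eqF//; have := d_ge0 u; have := d_ge0 v.
  by case/orP: uv0 => /d_gt0; lra.
move: Au Av; rewrite b0 !scale0r subr0 add0r => Au Av.
by case/orP: uv0 => h; [exists a, u|exists a, v].
Qed.

Section Exp.
Context {R : realType}.
Implicit Types (x y : R) (k : nat).

Definition exp_taylor k : {poly R} := \poly_(i < k.+1) (i`!%:R)^-1.

Lemma size_exp_taylor k : ((size (exp_taylor k)).-1 <= k)%N.
Proof. by have := size_poly k.+1 (fun i => i`!%:R^-1 : R); case: size. Qed.

Lemma horner_exp_taylor k y : (exp_taylor k).[y] = series (exp_coeff y) k.+1.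
Proof.
rewrite horner_poly /series /= big_mkord; apply: eq_bigr => i _.
by rewrite /exp_coeff /= mulrC.
Qed.

Lemma exp_taylor_le k y : 0 <= y -> (exp_taylor k).[y] <= expR y.
Proof.
move=> y0; rewrite horner_exp_taylor; apply: nondecreasing_cvgn_le.
  apply/nondecreasing_seqP => n; rewrite /series /= big_nat_recr //= lerDl.
  exact: exp_coeff_ge0.
exact: is_cvg_series_exp_coeff.
Qed.

Lemma exp_taylor_gt0 k y : 0 <= y -> 0 < (exp_taylor k).[y].
Proof.
move=> y0; rewrite horner_exp_taylor /series /= big_nat_recl//= ltr_pwDl//.
  by rewrite /exp_coeff /= expr0 fact0 divr1.
by rewrite sumr_ge0// => i _; exact: exp_coeff_ge0.
Qed.

(* Up to the factor [expR y], this is Markov's inequality for a Poisson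
   variable of mean [y]. *)
Lemma exp_taylor_ge k y : 0 <= y -> (0 < k)%N ->
  (1 - y / k%:R) * expR y <= (exp_taylor k).[y].
Proof.
move=> y0 k0; have k0R : 0 < k%:R :> R by rewrite ltr0n.
suff tail m : series (exp_coeff y) (k.+1 + m)%N <=
    (exp_taylor k).[y] + y / k%:R * expR y.
  suff : expR y <= (exp_taylor k).[y] + y / k%:R * expR y by lra.
  apply: limr_le; first exact: is_cvg_series_exp_coeff.
  exists k.+1 => // n /= kn; have := tail (n - k.+1)%N.
  by rewrite subnKC.
have -> : series (exp_coeff y) (k.+1 + m)%N =
    (exp_taylor k).[y] + \sum_(k.+1 <= j < k.+1 + m) exp_coeff y j.
  by rewrite horner_exp_taylor /series /= -big_cat_nat// leq_addr.
rewrite lerD2l.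
apply: (@le_trans _ _
  (\sum_(k.+1 <= j < k.+1 + m) (y / k%:R * exp_coeff y j.-1))).
  rewrite !big_nat; apply: ler_sum => -[//|j] /andP[kj _] /=.
  have j0 : (0 : R) < j.+1%:R by rewrite ltr0n.
  have f0 : (0 : R) < j`!%:R by rewrite ltr0n fact_gt0.
  rewrite /exp_coeff /= factS natrM exprS.
  have -> : y / k%:R * (y ^+ j / j`!%:R) =
     (y * y ^+ j / (j.+1%:R * j`!%:R)) * (j.+1%:R / k%:R).
    by field; rewrite !gt_eqF.
  rewrite ler_peMr ?divr_ge0 ?mulr_ge0 ?exprn_ge0 ?ler0n//.
  by rewrite ler_pdivlMr// mul1r ler_nat ltnW.
rewrite -mulr_sumr ler_wpM2l ?divr_ge0 ?ler0n// addSn big_add1 /=.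
apply: (le_trans _ (exp_taylor_le (k + m) y0)).
rewrite horner_exp_taylor /series /=.
rewrite (@big_cat_nat _ _ _ k 0%N (k + m).+1)//=; last first.
  by rewrite leqW// leq_addr.
rewrite big_nat_recr ?leq_addr//=.
rewrite -[leLHS]add0r lerD//.
  by rewrite sumr_ge0// => i _; exact: exp_coeff_ge0.
by rewrite lerDl exp_coeff_ge0.
Qed.

Lemma ln_exp_taylor k y : 0 <= y -> y *+ 2 <= k%:R -> (0 < k)%N ->
  y - ln 2 <= ln (exp_taylor k).[y] <= y.
Proof.
move=> y0 yk k0.
have k0R : 0 < k%:R :> R by rewrite ltr0n.
have h : expR y / 2 <= (exp_taylor k).[y].
  apply: le_trans (exp_taylor_ge y0 k0); rewrite mulrC ler_wpM2r ?expR_ge0//.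
  have : y / k%:R <= 1 / 2 by rewrite ler_pdivrMr//; lra.
  by lra.
have h0 : 0 < expR y / 2 by rewrite divr_gt0 ?expR_gt0.
have h1 : 0 < (exp_taylor k).[y] by apply: lt_le_trans h.
apply/andP; split.
  by rewrite -{1}(expRK y) -ln_div ?ler_ln ?posrE ?expR_gt0.
by rewrite -{2}(expRK y) ler_ln ?posrE ?expR_gt0// exp_taylor_le.
Qed.

Lemma mul_ln_sub_ge x y : 0 <= x -> 0 < y -> x - y <= x * (ln x - ln y).
Proof.
rewrite le0r => /orP[/eqP->|x0] y0; first by rewrite mul0r sub0r oppr_le0 ltW.
have : ln (1 + (y / x - 1)) <= y / x - 1.
  by apply: le_ln1Dx; rewrite ltrBrDl subrr divr_gt0.
rewrite addrCA subrr addr0 ln_div ?posrE// => h.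
have -> : x - y = x * (1 - y / x) by field; rewrite gt_eqF.
by rewrite ler_pM2l//; lra.
Qed.

End Exp.

Section DotTheory.
Context {R : realType} {H : vectType R} (dot : {dot H for idfun}).
Implicit Types (u v w : H) (A B : 'End(H)).

Lemma dotC u v : dot u v = dot v u.
Proof. by rewrite hermC expr0 mul1r. Qed.

Lemma dotDl u v w : dot (u + v) w = dot u w + dot v w.
Proof. exact: linearDl. Qed.

Lemma dotZl a u w : dot (a *: u) w = a * dot u w.
Proof. exact: linearZl_LR. Qed.

Lemma dotZr a u w : dot w (a *: u) = a * dot w u.
Proof. by rewrite dotC dotZl dotC. Qed.

Lemma dot0l w : dot 0 w = 0.
Proof. by rewrite -(scale0r 0) dotZl mul0r. Qed.

Lemma dotBl u v w : dot (u - v) w = dot u w - dot v w.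
Proof. by rewrite -scaleN1r dotDl dotZl mulN1r. Qed.

Lemma dot_suml I (r : seq I) (P : pred I) (f : I -> H) w :
  dot (\sum_(i <- r | P i) f i) w = \sum_(i <- r | P i) dot (f i) w.
Proof.
by apply: (big_morph (fun x => dot x w)) => [x y|]; rewrite ?dotDl ?dot0l.
Qed.

Lemma dot_gt0 u : u != 0 -> 0 < dot u u.
Proof. exact: neq0_dnorm_gt0. Qed.

Lemma dot_ge0 u : 0 <= dot u u.
Proof. by have [->|/dot_gt0/ltW//] := eqVneq u 0; rewrite dot0l. Qed.

Definition orthonormal_basis n (e : 'I_n -> H) :=
  (forall i j, dot (e i) (e j) = (i == j)%:R) /\
  (forall v, v = \sum_i dot v (e i) *: e i).

Lemma unit_eigenvector_in A (U : {vspace H}) :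
  self_adjoint dot A -> (forall u, u \in U -> A u \in U) -> U != 0%VS ->
  exists l v, [/\ v \in U, dot v v = 1 & A v = l *: v].
Proof.
move=> sA AU U0.
pose AS : 'End(subvs_of U) := linfun (vsproj U \o A \o vsval).
have ASE (u : subvs_of U) : vsval (AS u) = A (vsval u).
  by rewrite lfunE /= vsprojK ?AU ?subvsP.
have [] := @symmetric_eigenvector R (subvs_of U) AS
  (fun x y => dot (vsval x) (vsval y)).
- by move=> a u v w; rewrite linearP dotDl dotZl.
- by move=> u v; rewrite dotC.
- move=> u u0; apply: dot_gt0; apply: contra u0 => /eqP u0; apply/eqP.
  by apply: subvs_inj; rewrite u0 linear0.
- by move=> u v; rewrite !ASE.
- by rewrite lt0n; move: U0; rewrite -dimv_eq0.
move=> l [v [v0 Av]].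
have v0' : vsval v != 0.
  move: v0; apply: contraNN => /eqP v0; apply/eqP.
  by apply: subvs_inj; rewrite v0 linear0.
have n0 := dot_gt0 v0'.
exists l, ((Num.sqrt (dot (vsval v) (vsval v)))^-1 *: vsval v); split.
- by rewrite rpredZ ?subvsP.
- rewrite dotZl dotZr mulrA -expr2 exprVn sqr_sqrtr ?ltW// mulVf//.
  by rewrite gt_eqF.
- by rewrite linearZ /= -ASE Av linearZ /= !scalerA mulrC.
Qed.

Lemma spectral_theorem_in A (U : {vspace H}) : self_adjoint dot A ->
  (forall u, u \in U -> A u \in U) ->
  exists n (e : 'I_n -> H) (l : 'I_n -> R),
    [/\ forall i, e i \in U, forall i j, dot (e i) (e j) = (i == j)%:R,
       forall v, v \in U -> v = \sum_i dot v (e i) *: e i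
     & forall i, A (e i) = l i *: e i].
Proof.
move=> sA; have [m] := ubnP (\dim U); elim: m U => // m IH U dU AU.
have [->|U0] := eqVneq U 0%VS.
  exists 0%N, (fun=> 0), (fun=> 0); split => [[]//|[]//|v|[]//].
  by rewrite memv0 => /eqP ->; rewrite big_ord0.
have [l0 [x [xU xx Ax]]] := unit_eigenvector_in sA AU U0.
pose fx : 'Hom(H, R^o) := linfun (fun v => dot x v : R^o).
have fxE v : fx v = dot x v by rewrite lfunE.
pose W := (U :&: lker fx)%VS.
have WE v : (v \in W) = (v \in U) && (dot x v == 0).
  by rewrite memv_cap memv_ker fxE.
have xW : x \notin W by rewrite WE xx xU oner_eq0.
have WU : (W <= U)%VS by apply: capvSl.
have dW : (\dim W < m)%N.
  rewrite -ltnS; apply: leq_trans dU; rewrite ltnS ltn_neqAle dimvS// andbT.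
  apply: contra xW => /eqP h.
  by have /eqP -> : W == U by rewrite eqEdim WU h leqnn.
have [|n [e [l [eW ee eC Ae]]]] := IH W dW.
  move=> u; rewrite !WE => /andP[uU /eqP ux]; rewrite AU//=.
  by rewrite -sA Ax dotZl ux mulr0.
have eU i : e i \in U by have := eW i; rewrite WE => /andP[].
have xe i : dot x (e i) = 0 by have := eW i; rewrite WE => /andP[_ /eqP].
exists n.+1, (fun i => oapp e x (unlift ord0 i)).
exists (fun i => oapp l l0 (unlift ord0 i)); split.
- by move=> i; case: unliftP => [j|] _ /=.
- move=> i j; case: unliftP => [i'|] -> /=; case: unliftP => [j'|] -> /=.
  + by rewrite ee (inj_eq lift_inj).
  + by rewrite dotC xe.
  + by rewrite xe.
  + by rewrite xx.
- move=> v vU; rewrite big_ord_recl unlift_none /=.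
  have vW : v - dot v x *: x \in W.
    by rewrite WE rpredB ?rpredZ//= dotC dotBl dotZl xx mulr1 subrr.
  rewrite -[LHS](subrK (dot v x *: x)) addrC; congr (_ + _).
  rewrite [LHS](eC _ vW); apply: eq_bigr => i _.
  by rewrite liftK /= dotBl dotZl xe mulr0 subr0.
- by move=> i; case: unliftP => [j|] _ /=.
Qed.

Lemma spectral_theorem A : self_adjoint dot A ->
  exists n (e : 'I_n -> H) (l : 'I_n -> R),
    orthonormal_basis e /\ forall i, A (e i) = l i *: e i.
Proof.
move=> sA; have [|n [e [l [_ ee eC Ae]]]] := @spectral_theorem_in A fullv sA.
  by move=> *; apply: memvf.
by exists n, e, l; split=> //; split=> // v; apply: eC; rewrite memvf.
Qed.

Section Basis.
Context {n} {e : 'I_n -> H} (onb : orthonormal_basis e).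

Lemma dot_basis u v : dot u v = \sum_i dot u (e i) * dot v (e i).
Proof.
rewrite {1}(onb.2 u) dot_suml; apply: eq_bigr => i _.
by rewrite dotZl (dotC (e i)).
Qed.

Lemma optrace_basis A : optrace A = \sum_i dot (A (e i)) (e i).
Proof.
have bB := vbasisP {: H}; set b := vbasis _ in bB.
have -> : optrace A = \sum_(i < \dim {:H}) coord b i (A b`_i).
  by apply: eq_bigr => i _; rewrite !mxE /= vecof_delta.
transitivity (\sum_(i < \dim {:H}) \sum_j dot b`_i (e j) * coord b i (A (e j))).
  apply: eq_bigr => i _; rewrite {1}(onb.2 b`_i) !linear_sum /=.
  by apply: eq_bigr => j _; rewrite !linearZ.
rewrite exchange_big; apply: eq_bigr => j _ /=.
rewrite [X in _ = dot X _](coord_basis bB) ?memvf// dot_suml.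
by apply: eq_bigr => i _; rewrite dotZl mulrC.
Qed.

Section Diagonal.
Variables (A : 'End(H)) (a : 'I_n -> R).
Hypothesis Ae : forall i, A (e i) = a i *: e i.

Lemma optrace_diag : optrace A = \sum_i a i.
Proof.
rewrite optrace_basis; apply: eq_bigr => i _.
by rewrite Ae dotZl onb.1 eqxx mulr1.
Qed.

Lemma dot_diag u i : dot (A u) (e i) = a i * dot u (e i).
Proof.
rewrite (onb.2 u) linear_sum !dot_suml mulr_sumr; apply: eq_bigr => j _.
rewrite linearZ /= Ae !dotZl onb.1.
by case: eqP => [->|]; rewrite ?(mulr0, mulr1) // mulrC.
Qed.

Lemma self_adjoint_diag : self_adjoint dot A.
Proof.
move=> u v; rewrite !dot_basis; apply: eq_bigr => i _.
by rewrite !dot_diag; ring.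
Qed.

Lemma pos_semidef_diag : (forall i, 0 <= a i) -> pos_semidef dot A.
Proof.
move=> a0 u; rewrite dot_basis sumr_ge0// => i _.
by rewrite dot_diag -mulrA mulr_ge0// -expr2 sqr_ge0.
Qed.

Lemma opfun_diag f i : opfun f A (e i) = f (a i) *: e i.
Proof.
suff ex : exists B : 'End(H), forall l v, A v = l *: v -> B v = f l *: v.
  by have := xgetPex 0 ex; apply.
pose g v := \sum_i (f (a i) * dot v (e i)) *: e i.
have g_linear : linear g.
  move=> c u v; rewrite scaler_sumr -big_split; apply: eq_bigr => j _ /=.
  by rewrite dotDl dotZl scalerA -scalerDl; congr (_ *: _); ring.
pose G : {linear H -> H} := HB.pack g
  (GRing.isLinear.Build _ _ _ _ g g_linear).
exists (linfun G) => l v Av; rewrite lfunE /= /g [in RHS](onb.2 v) scaler_sumr.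
apply: eq_bigr => j _; rewrite scalerA; have [->|v0] := eqVneq (dot v (e j)) 0.
  by rewrite !mulr0.
suff /(mulIf v0) -> : a j * dot v (e j) = l * dot v (e j) by [].
by rewrite -dot_diag Av dotZl.
Qed.

Lemma oppow_diag k i : oppow A k (e i) = a i ^+ k *: e i.
Proof.
elim: k => [|k IH]; first by rewrite lfunE /= scale1r.
by rewrite /oppow iterS lfunE /= IH linearZ /= Ae scalerA exprSr.
Qed.

Lemma oppoly_diag p i : oppoly p A (e i) = p.[a i] *: e i.
Proof.
rewrite /oppoly sum_lfunE horner_coef scaler_suml; apply: eq_bigr => j _.
by rewrite lfunE /= oppow_diag scalerA.
Qed.

End Diagonal.

Lemma optrace_id : optrace (\1%VF : 'End(H)) = n%:R.
Proof.
rewrite (optrace_diag (a := fun=> 1)) ?sumr_const ?card_ord// => i.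
by rewrite id_lfunE scale1r.
Qed.

Lemma poly_density_diag A a p i : (forall i, A (e i) = a i *: e i) ->
  poly_density p A (e i) = (p.[a i] ^+ 2 / \sum_j p.[a j] ^+ 2) *: e i.
Proof.
move=> Ae.
have BB j : (oppoly p A \o oppoly p A)%VF (e j) = p.[a j] ^+ 2 *: e j.
  rewrite lfunE /= (oppoly_diag Ae) linearZ /= (oppoly_diag Ae).
  by rewrite scalerA -expr2.
by rewrite /poly_density (optrace_diag BB) lfunE /= BB scalerA mulrC.
Qed.

Lemma density_op_diag A a : (forall i, A (e i) = a i *: e i) ->
  (forall i, 0 <= a i) -> \sum_i a i = 1 -> density_op dot A.
Proof.
move=> Ae a0 a1; split.
- exact: self_adjoint_diag Ae.
- exact: (pos_semidef_diag Ae).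
- by rewrite (optrace_diag Ae).
Qed.

Lemma eigenvalue_le_opnorm A a i : (forall i, A (e i) = a i *: e i) ->
  `|a i| <= opnorm dot A.
Proof.
move=> Ae; have vnorm_e : vnorm dot (e i) = 1.
  by rewrite /vnorm onb.1 eqxx sqrtr1.
have -> : `|a i| = vnorm dot (A (e i)).
  by rewrite /vnorm Ae dotZl dotZr onb.1 eqxx mulr1 -expr2 sqrtr_sqr.
apply: ub_le_sup; last by exists (e i); rewrite ?vnorm_e.
exists (Num.sqrt (\sum_j a j ^+ 2)) => _ [u u1 ->].
rewrite ler_sqrt ?sumr_ge0// => [|j _]; last exact: sqr_ge0.
have uu : dot u u <= 1.
  by rewrite -(sqr_sqrtr (dot_ge0 u)) expr_le1 ?sqrtr_ge0.
rewrite dot_basis; apply: ler_sum => j _; rewrite (dot_diag Ae).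
rewrite -expr2 exprMn ler_piMr ?sqr_ge0//; apply: le_trans uu.
rewrite (dot_basis u u) (bigD1 j)//= expr2 lerDl sumr_ge0// => k _.
by rewrite -expr2 sqr_ge0.
Qed.

End Basis.

Section Entropy.
Context {n} {e : 'I_n -> H} (onb : orthonormal_basis e).
Variables (Q : 'End(H)) (mu : 'I_n -> R).
Hypothesis Qe : forall j, Q (e j) = mu j *: e j.

Lemma eigenvalue_ge0 j : pos_semidef dot Q -> 0 <= mu j.
Proof.
by move=> /(_ (e j)); rewrite Qe dotZl onb.1 eqxx mulr1.
Qed.

Lemma rel_entropy_uniform : optrace Q = 1 ->
  rel_entropy Q (uniform_density H) = \sum_j mu j * ln (mu j) + ln n%:R.
Proof.
rewrite (optrace_diag onb Qe) => mu1.
have n0 : 0 < n%:R :> R.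
  rewrite ltr0n; case: (n) mu mu1 => // m'.
  by rewrite big_ord0 => /esym/eqP; rewrite oner_eq0.
have Ue j : uniform_density H (e j) = n%:R^-1 *: e j.
  by rewrite /uniform_density (optrace_id onb) lfunE /= id_lfunE.
rewrite /rel_entropy (optrace_diag onb
  (a := fun j => mu j * (ln (mu j) + ln n%:R))).
  under eq_bigr do rewrite mulrDr.
  by rewrite big_split /= -mulr_suml mu1 mul1r.
move=> j; rewrite lfunE /= !lfunE /= !lfunE /= /oplog.
rewrite (opfun_diag onb Qe) (opfun_diag onb (a := fun=> n%:R^-1) Ue).
by rewrite -scalerBl linearZ /= Qe scalerA lnV ?posrE// opprK mulrC.
Qed.

Lemma klein_inequality m (f : 'I_m -> H) (w : 'I_m -> R) :
  orthonormal_basis f -> (forall j, 0 <= mu j) -> (forall i, 0 < w i) ->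
  \sum_i w i = \sum_j mu j ->
  \sum_i dot (Q (f i)) (f i) * ln (w i) <= \sum_j mu j * ln (mu j).
Proof.
move=> fb mu0 w0 wmu.
pose D i j := dot (f i) (e j) ^+ 2.
have Dr i : \sum_j D i j = 1.
  transitivity (dot (f i) (f i)); last by rewrite fb.1 eqxx.
  rewrite (dot_basis onb).
  by apply: eq_bigr => j _; rewrite /D expr2.
have Dc j : \sum_i D i j = 1.
  transitivity (dot (e j) (e j)); last by rewrite onb.1 eqxx.
  rewrite (dot_basis fb).
  by apply: eq_bigr => i _; rewrite /D expr2 (dotC (f i)).
have -> : \sum_i dot (Q (f i)) (f i) * ln (w i) =
    \sum_j \sum_i D i j * (mu j * ln (w i)).
  rewrite exchange_big; apply: eq_bigr => i _ /=.
  rewrite (dot_basis onb) mulr_suml; apply: eq_bigr => j _.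
  by rewrite (dot_diag onb Qe) /D; ring.
have -> : \sum_j mu j * ln (mu j) =
    \sum_j \sum_i D i j * (mu j * ln (mu j)).
  by apply: eq_bigr => j _; rewrite -mulr_suml Dc mul1r.
have /subr0_eq h0 :
    \sum_j \sum_i D i j * mu j - \sum_j \sum_i D i j * w i = 0.
  under eq_bigr do rewrite -mulr_suml Dc mul1r.
  rewrite [X in _ - X]exchange_big /=.
  under [X in _ - X]eq_bigr do rewrite -mulr_suml Dr mul1r.
  by rewrite wmu subrr.
rewrite -subr_ge0 -sumrB.
apply: (@le_trans _ _
  (\sum_j \sum_i D i j * mu j - \sum_j \sum_i D i j * w i)).
  by rewrite h0 subrr.
rewrite -sumrB; apply: ler_sum => j _; rewrite -!sumrB; apply: ler_sum => i _.
rewrite -!mulrBr ler_wpM2l ?sqr_ge0//.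
exact: mul_ln_sub_ge.
Qed.

End Entropy.
End DotTheory.

Lemma gibbs_inequality {R : realType} n (u v : 'I_n -> R) :
  (forall i, 0 <= u i) -> (forall i, 0 < v i) -> \sum_i u i = \sum_i v i ->
  \sum_i u i * ln (v i) <= \sum_i u i * ln (u i).
Proof.
move=> u0 v0 uv; rewrite -subr_ge0 -sumrB.
apply: (@le_trans _ _ (\sum_i (u i - v i))); first by rewrite sumrB uv subrr.
by apply: ler_sum => i _; rewrite -mulrBr mul_ln_sub_ge.
Qed.

Section Variational.
Context {R : realType} {H : vectType R} (dot : {dot H for idfun}).
Context {n} {f : 'I_n -> H} (onb : orthonormal_basis dot f).
Variables (F Q : 'End(H)) (l : 'I_n -> R).
Hypotheses (Fe : forall i, F (f i) = l i *: f i) (dQ : density_op dot Q).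
Let q i := dot (Q (f i)) (f i).
Let s := rel_entropy Q (uniform_density H).

Lemma density_dim_gt0 : (0 < n)%N.
Proof.
case: dQ => _ _; rewrite (optrace_basis onb); case: (n) f => // g.
by rewrite big_ord0 => /esym/eqP; rewrite oner_eq0.
Qed.

Lemma density_diag_ge0 i : 0 <= q i.
Proof. by case: dQ => _ + _; apply. Qed.

Lemma sum_density_diag : \sum_i q i = 1.
Proof. by case: dQ => _ _ <-; rewrite (optrace_basis onb). Qed.

Lemma optrace_diag_comp A :
  optrace (F \o A)%VF = \sum_i l i * dot (A (f i)) (f i).
Proof.
rewrite (optrace_basis onb); apply: eq_bigr => i _.
by rewrite lfunE /= (dot_diag onb Fe).
Qed.

Lemma cross_entropy_le (w : 'I_n -> R) : (forall i, 0 < w i) ->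
  \sum_i w i = 1 -> \sum_i q i * ln (w i) + ln n%:R <= s.
Proof.
move=> w0 w1; case: (dQ) => sQ pQ tQ.
have [m [e [mu [eb Qe]]]] := spectral_theorem sQ.
have mn : m%:R = n%:R :> R by rewrite -(optrace_id eb) (optrace_id onb).
rewrite /s (rel_entropy_uniform eb Qe)// mn lerD2r.
apply: (klein_inequality eb Qe onb _ w0) => [j|].
  exact: (eigenvalue_ge0 eb Qe).
by rewrite w1 -(optrace_diag eb Qe).
Qed.

Lemma rel_entropy_ge0 : 0 <= s.
Proof.
have n0 : 0 < n%:R :> R by rewrite ltr0n density_dim_gt0.
apply: le_trans (cross_entropy_le (w := fun=> n%:R^-1) _ _).
- by rewrite -mulr_suml sum_density_diag mul1r lnV ?posrE// addNr.
- by move=> i; rewrite invr_gt0.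
- by rewrite sumr_const card_ord -[LHS]mulr_natr mulVf ?gt_eqF.
Qed.

(* [c / Z] minimises [X |-> - \sum X ln c + S(X || U)]; its own entropy term is
   nonnegative and dropped. *)
Lemma gibbs_variational (c : 'I_n -> R) (Z := \sum_i c i) :
  (forall i, 0 < c i) ->
  \sum_i q i * ln (c i) <= \sum_i c i / Z * ln (c i) + s.
Proof.
move=> c0.
have n0 : 0 < n%:R :> R by rewrite ltr0n density_dim_gt0.
have Z0 : 0 < Z.
  rewrite /Z (bigD1 (Ordinal density_dim_gt0))//= ltr_pwDl//.
  by rewrite sumr_ge0// => i _; exact: ltW.
have w0 i : 0 < c i / Z by rewrite divr_gt0.
have w1 : \sum_i c i / Z = 1 by rewrite -mulr_suml mulfV ?gt_eqF.
have lnw i : ln (c i / Z) = ln (c i) - ln Z by rewrite ln_div ?posrE.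
have ln_sum (v : 'I_n -> R) : \sum_i v i = 1 ->
    \sum_i v i * ln (c i / Z) = \sum_i v i * ln (c i) - ln Z.
  move=> v1; under eq_bigr do rewrite lnw mulrBr.
  by rewrite sumrB -mulr_suml v1 mul1r.
have w_entropy : - ln n%:R <= \sum_i c i / Z * ln (c i / Z).
  rewrite -lnV ?posrE// -[leLHS]mul1r -[X in X * _]w1 mulr_suml.
  apply: (gibbs_inequality (u := fun i => c i / Z) (v := fun=> n%:R^-1))
    => [i|i|]; first exact: ltW.
    by rewrite invr_gt0.
  by rewrite w1 sumr_const card_ord -[RHS]mulr_natr mulVf ?gt_eqF.
have := cross_entropy_le w0 w1; move: w_entropy.
by rewrite !ln_sum ?sum_density_diag//; lra.
Qed.

Section PolyDensity.
Variables (p : {poly R}).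
Hypothesis p0 : forall i, p.[l i] != 0.
Let Z := \sum_i p.[l i] ^+ 2.
Let w i := p.[l i] ^+ 2 / Z.

Lemma sum_sqr_horner_gt0 : 0 < Z.
Proof.
rewrite /Z (bigD1 (Ordinal density_dim_gt0))//= ltr_pwDl//.
  by rewrite exprn_even_gt0//= p0.
by rewrite sumr_ge0// => i _; exact: sqr_ge0.
Qed.

Lemma poly_weight_ge0 i : 0 <= w i.
Proof. by rewrite divr_ge0 ?sqr_ge0 ?ltW ?sum_sqr_horner_gt0. Qed.

Lemma sum_poly_weight : \sum_i w i = 1.
Proof. by rewrite -mulr_suml mulfV ?gt_eqF ?sum_sqr_horner_gt0. Qed.

Lemma density_op_poly_density : density_op dot (poly_density p F).
Proof.
apply: (density_op_diag onb (fun i => poly_density_diag onb p i Fe)).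
  exact: poly_weight_ge0.
exact: sum_poly_weight.
Qed.

Lemma optrace_poly_density :
  optrace (F \o poly_density p F)%VF = \sum_i w i * l i.
Proof.
rewrite optrace_diag_comp; apply: eq_bigr => i _.
by rewrite (poly_density_diag onb p i Fe) dotZl onb.1 eqxx mulr1 mulrC.
Qed.

End PolyDensity.
End Variational.

Lemma ln2_le1 (R : realType) : ln 2 <= 1 :> R.
Proof. by apply: (le_trans (@le_ln1Dx R 1 _)) => //; lra. Qed.

Theorem theorem3p4 (R : realType) :
  exists2 C : R, 0 < C &
    forall (H : vectType R) (dot : {dot H for idfun}) (F Q : 'End(H)),
      self_adjoint dot F ->
      density_op dot Q ->
      forall eps : R, 0 < eps ->
        exists p : {poly R},
          [/\ (size p).-1%:R <=
                C * (1 + rel_entropy Q (uniform_density H))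
                  * opnorm dot F / eps,
              density_op dot (poly_density p F) &
              optrace (F \o poly_density p F)%VF <=
                optrace (F \o Q)%VF + eps].
Proof.
exists 6 => // H dot F Q sF dQ eps eps0.
have [n [f [l [onb Fe]]]] := spectral_theorem sF.
have n0 := density_dim_gt0 onb dQ.
have s0 := rel_entropy_ge0 onb dQ.
set s := rel_entropy _ _ in s0 *; set M := opnorm dot F.
have lM i : - M <= l i <= M.
  by rewrite -ler_norml (eigenvalue_le_opnorm onb _ Fe).
have M0 : 0 <= M.
  by apply: le_trans (eigenvalue_le_opnorm onb (Ordinal n0) Fe).
pose q i := dot (Q (f i)) (f i).
have q0 i : 0 <= q i by exact: density_diag_ge0.
have q1 : \sum_i q i = 1 := sum_density_diag onb dQ.
have trFQ : optrace (F \o Q)%VF = \sum_i q i * l i.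
  by rewrite (optrace_diag_comp onb Fe); apply: eq_bigr => i _; rewrite mulrC.
have [Meps|epsM] := leP (2 * M) eps.
  have p0 i : (1 : {poly R}).[l i] != 0 by rewrite hornerE oner_eq0.
  exists 1; split; last 1 first.
  - rewrite (optrace_poly_density onb Fe) trFQ.
    have w0 := poly_weight_ge0 onb dQ p0; have w1 := sum_poly_weight onb dQ p0.
    apply: (@le_trans _ _ M).
      rewrite -[leRHS]mul1r -w1 mulr_suml; apply: ler_sum => i _.
      by rewrite ler_wpM2l// (andP (lM i)).2.
    apply: (@le_trans _ _ (- M + eps)); first by lra.
    rewrite lerD2r -[leLHS]mul1r -q1 mulr_suml; apply: ler_sum => i _.
    by rewrite ler_wpM2l// (andP (lM i)).1.
  - by rewrite size_poly1 !mulr_ge0 ?invr_ge0 ?addr_ge0// ltW.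
  - exact: (density_op_poly_density onb Fe dQ).
pose b := 2 * (1 + s) / eps.
have b0 : 0 < b by rewrite divr_gt0//; lra.
have b2 : 0 <= b / 2 by rewrite divr_ge0// ltW.
pose k := (Num.truncn (2 * b * M)).+1.
have bM0 : 0 <= 2 * b * M by rewrite mulr_ge0// mulr_ge0// ltW.
have /andP[k_le k_gt] := truncn_itv bM0.
pose y i := b / 2 * (M - l i).
pose p := exp_taylor k \Po ((b / 2) *: (M%:P - 'X)).
have pE i : p.[l i] = (exp_taylor k).[y i] by rewrite horner_comp !hornerE.
have y0 i : 0 <= y i.
  by rewrite mulr_ge0// subr_ge0 (andP (lM i)).2.
have lnT i : y i - ln 2 <= ln (exp_taylor k).[y i] <= y i.
  apply: ln_exp_taylor => //; apply: le_trans (ltW k_gt).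
  have -> : 2 * b * M = (b / 2 * (2 * M)) *+ 2 by field.
  rewrite lerMn2r ler_wpM2l//=.
  by have := lM i; lra.
have p_gt0 i : 0 < p.[l i] by rewrite pE exp_taylor_gt0.
have p0 i : p.[l i] != 0 by rewrite gt_eqF.
exists p; split; last 1 first.
- pose w i := p.[l i] ^+ 2 / \sum_j p.[l j] ^+ 2.
  have -> : optrace (F \o poly_density p F)%VF = \sum_i w i * l i.
    exact: (optrace_poly_density onb Fe).
  have w0 i : 0 <= w i := poly_weight_ge0 onb dQ p0 i.
  have w1 : \sum_i w i = 1 := sum_poly_weight onb dQ p0.
  have lnc i : ln (p.[l i] ^+ 2) = 2 * ln (exp_taylor k).[y i].
    by rewrite lnXn// pE mulr_natl.
  have gv : \sum_i q i * ln (p.[l i] ^+ 2) <=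
      \sum_i w i * ln (p.[l i] ^+ 2) + s.
    by apply: (gibbs_variational onb dQ) => i; rewrite exprn_gt0.
  have lo : \sum_i q i * (2 * y i - 2) <= \sum_i q i * ln (p.[l i] ^+ 2).
    apply: ler_sum => i _; rewrite ler_wpM2l// lnc.
    by have := lnT i; have := ln2_le1 R; lra.
  have hi : \sum_i w i * ln (p.[l i] ^+ 2) <= \sum_i w i * (2 * y i).
    apply: ler_sum => i _; rewrite ler_wpM2l// lnc.
    by have := lnT i; lra.
  have yE (v : 'I_n -> R) c : \sum_i v i = 1 ->
      \sum_i v i * (2 * y i + c) = b * M + c - b * \sum_i v i * l i.
    move=> v1; rewrite -[b * M + c]mul1r -[X in X * (_ + c)]v1.
    rewrite mulr_suml mulr_sumr -sumrB.
    by apply: eq_bigr => i _; rewrite /y; field.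
  have := yE q (-2) q1; have := yE w 0 w1.
  under eq_bigr do rewrite addr0.
  move=> h1 h2; rewrite -(ler_pM2l b0) mulrDr.
  have -> : b * eps = 2 * (1 + s) by rewrite /b; field; rewrite gt_eqF.
  by rewrite trFQ; lra.
- have szp : ((size p).-1 <= k)%N.
    have sz2 : size ((b / 2) *: (M%:P - 'X)) = 2%N.
      rewrite size_scale; last by rewrite gt_eqF// divr_gt0.
      by rewrite -opprB size_polyN size_XsubC.
    by rewrite size_comp_poly2// size_exp_taylor.
  apply: (@le_trans _ _ k%:R); first by rewrite ler_nat.
  rewrite /k -natr1.
  have -> : 6 * (1 + s) * M / eps = 2 * b * M + (1 + s) * (2 * M / eps).
    by rewrite /b; field; rewrite gt_eqF.
  rewrite lerD//; have h : 1 <= 2 * M / eps by rewrite ler_pdivlMr// mul1r ltW.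
  by apply: (le_trans h); rewrite ler_peMl//; lra.
- exact: (density_op_poly_density onb Fe dQ).
Qed.
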